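(* Let $V_a$, $\{V_{a_i}\}_{i\in\mathbb{N}}$, $\{R_i\}_{i\in\mathbb{N}}$ be a space splitting as in the context, and assume that for some constant $\Lambda$ one has $\|R_iv_i\|_a\le \Lambda\|v_i\|_{a_i}$ for all $v_i\in V_{a_i}$, $i\in\mathbb{N}$. For any $e\in V_a$, denote $r_i=T_ie\in V_{a_i}$ and $w_i=\|r_i\|_{a_i}^{-1}R_ir_i\in V_a$ (with $w_i:=0$ if $r_i=0$), $i\in\mathbb{N}$. a) If $i^\ast\in\mathbb{N}$ is such that $\|r_{i^\ast}\|_{a_{i^\ast}}\ge\beta\sup_{i\in\mathbb{N}}\|r_i\|_{a_i}$ for some $0<\beta\le1$, then, for any nontrivial $h\in\mathcal{A}_1$, $$\|r_{i^\ast}\|_{a_{i^\ast}}=a(e,w_{i^\ast})\ge\frac{\beta}{\|h\|_{\mathcal{A}_1}}\,\mathrm{Re}\,a(e,h).$$ b) If $\pi=\{\pi_i\}_{i\in\mathbb{N}}$ is any discrete probability distribution, then, for any nontrivial $h\in\mathcal{A}^\pi_\infty$, $$\sum_{i\in\mathbb{N}}\pi_i\|r_i\|_{a_i}=\sum_{i\in\mathbb{N}}\pi_i\,a(e,w_i)\ge\frac{1}{\|h\|_{\mathcal{A}^\pi_\infty}}\,\mathrm{Re}\,a(e,h).$$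
   Context: **Setting.** $V$ is a separable real or complex Hilbert space, $a(\cdot,\cdot)$ is a continuous coercive Hermitian form on $V$, and $V_a$ denotes $V$ equipped with the (equivalent) scalar product $a$ and norm $\|v\|_a=a(v,v)^{1/2}$. For each $i\in\mathbb{N}$, $V_{a_i}$ is a Hilbert space with scalar product $a_i(\cdot,\cdot)$ and norm $\|\cdot\|_{a_i}$, and $R_i:V_{a_i}\to V_a$ is a bounded linear operator; $\mathrm{span}(\{R_iV_{a_i}\}_{i\in\mathbb{N}})$ is dense in $V_a$. Hermitian forms are linear in the first argument. (In the real case $\mathrm{Re}$ is redundant.) **Operators $T_i$.** $T_i:V_a\to V_{a_i}$ is defined by $a_i(T_iv,v_i)=a(v,R_iv_i)$ for all $v_i\in V_{a_i}$. **Approximation spaces.** A discrete probability distribution is a sequence $\pi=\{\pi_i\}_{i\in\mathbb{N}}$ with $\pi_i\ge0$, $\sum_i\pi_i=1$; $\mathrm{supp}(\pi)=\{i:\pi_i>0\}$. For a non-negative weight sequence $\gamma=\{\gamma_i\}_{i\in\mathbb{N}}$ and $0<q\le\infty$, define for $u\in\mathrm{span}(\{R_iV_{a_i}\}_{i\in\mathrm{supp}(\gamma)})$ $$\|u\|_{\mathcal{A}^\gamma_q}=\inf\left\{\big\|\{\gamma_i^{-1}\|v_i\|_{a_i}\}_{i\in I}\big\|_{\ell^q}:\ u=\sum_{i\in I}R_iv_i,\ v_i\in V_{a_i},\ I\subset\mathrm{supp}(\gamma)\text{ finite}\right\},$$ and let $\mathcal{A}^\gamma_q$ be the completion with respect to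 this (quasi-)norm. $\mathcal{A}_q$ denotes the case $\gamma_i=1$ for all $i$. For $\mathcal{A}_1$ and $\mathcal{A}_\infty^\pi$ one has $\|\cdot\|_a\le\Lambda\|\cdot\|_{\mathcal{A}}$ on finite sums, and elements of these completions are regarded as elements of $V_a$ via the continuous extension of the inclusion of the span into $V_a$. *)

(* Defs.v *)
From HB Require Import structures.
From mathcomp Require Import all_boot all_order all_algebra.
From mathcomp Require Import finmap complex.
From mathcomp Require Import all_classical all_reals all_analysis.

Set Implicit Arguments.
Unset Strict Implicit.
Unset Printing Implicit Defensive.

Import Order.TTheory GRing.Theory Num.Theory.
Import numFieldNormedType.Exports.

Local Open Scope classical_set_scope.
Local Open Scope ring_scope.

(* "Real or complex": the two scalar fields over a common field R of reals. *)
Variant scalar_kind := RealScalars | ComplexScalars.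

Definition scalar (R : realType) (k : scalar_kind) : numFieldType :=
  match k with
  | RealScalars => R : numFieldType
  | ComplexScalars => R[i] : numFieldType
  end.

Definition sconj (R : realType) (k : scalar_kind) : scalar R k -> scalar R k :=
  match k with
  | RealScalars => fun x => x
  | ComplexScalars => fun z => conjc z
  end.

Definition sre (R : realType) (k : scalar_kind) : scalar R k -> R :=
  match k with
  | RealScalars => fun x => x
  | ComplexScalars => fun z => complex.Re z
  end.

Definition sreal (R : realType) (k : scalar_kind) : R -> scalar R k :=
  match k with
  | RealScalars => fun x => x
  | ComplexScalars => fun x => Complex x 0
  end.
Arguments sreal {R} k x.

Record hilbert_space (R : realType) (k : scalar_kind) := HilbertSpace {
  hspace :> completeNormedModType (scalar R k);
  hdot : {dot hspace for @sconj R k};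
  hnormE : forall v : hspace, `|v| ^+ 2 = hdot v v
}.
Arguments hdot {R k} h.

Section Splitting.
Context {R : realType} {k : scalar_kind}.

Definition form_norm (V : lmodType (scalar R k)) (f : V -> V -> scalar R k)
  (v : V) : R := Num.sqrt (sre (f v v)).

Definition hnorm (V : hilbert_space R k) : V -> R := form_norm (hdot V).

Context (V : hilbert_space R k) (Vi : nat -> hilbert_space R k).
Context (Ri : forall i, {linear Vi i -> V}).
Implicit Types (J : set nat) (gamma : nat -> R) (q : \bar R).

Definition finite_sum (I : {fset nat}) (v : forall i, Vi i) : V :=
  \sum_(i <- I) Ri i (v i).

(* The linear span of the ranges R_i V_{a_i}, i in J. *)
Definition range_span J : set V :=
  [set u | exists (I : {fset nat}) (v : forall i, Vi i),
     [set` I] `<=` J /\ u = finite_sum I v].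

(* The last two clauses are relative to the norm of V_a, that is, V with the
   scalar product a. *)
Record space_splitting (a : {hermitian V for false & @sconj R k}) : Prop := {
  splitting_separable : exists2 D : set V, countable D & dense D;
  splitting_continuous : continuous (fun p : V * V => a p.1 p.2);
  splitting_coercive : exists2 c : R, 0 < c &
    forall v : V, c * hnorm v ^+ 2 <= sre (a v v);
  splitting_bounded : forall i, exists C : R, forall x : Vi i,
        form_norm a (Ri i x) <= C * hnorm x;
  splitting_dense : forall (v : V) (eps : R), 0 < eps ->
        exists2 u, range_span setT u & form_norm a (v - u) < eps
}.

Definition prob_distr (p : nat -> R) : Prop :=
  (forall i, 0 <= p i) /\ series p @ \oo --> (1 : R).

Definition supp gamma : set nat := [set i | 0 < gamma i].

(* The value at -oo is irrelevant: it is outside the range 0 < q <= +oo. *)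
Definition lq_norm q (s : seq R) : R :=
  match q with
  | EFin r => (\sum_(x <- s) `|x| `^ r) `^ r^-1
  | EPInf => \big[Num.max/0]_(x <- s) `|x|
  | ENInf => 0
  end.

Definition pre_norm gamma q (u : V) : R :=
  inf [set t | exists (I : {fset nat}) (v : forall i, Vi i),
    [/\ [set` I] `<=` supp gamma, u = finite_sum I v
      & t = lq_norm q [seq (gamma i)^-1 * hnorm (v i) | i <- I]]].

Definition pre_cauchy gamma q (x : nat -> V) : Prop :=
  (forall n, range_span (supp gamma) (x n)) /\
  (forall eps : R, 0 < eps -> exists N : nat, forall m n : nat,
     (N <= m)%N -> (N <= n)%N -> pre_norm gamma q (x m - x n) < eps).

Definition pre_equiv gamma q (x y : nat -> V) : Prop :=
  pre_norm gamma q (x n - y n) @[n --> \oo] --> (0 : R).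

(* The completion of the span for pre_norm: equivalence classes of
   Cauchy sequences. *)
Record approx_space gamma q := ApproxSpace {
  approx_class : set (nat -> V);
  approx_classP : exists2 x, pre_cauchy gamma q x &
    approx_class = [set y | pre_cauchy gamma q y /\ pre_equiv gamma q x y]
}.

Definition approx_nontrivial gamma q (h : approx_space gamma q) : Prop :=
  ~ approx_class h (fun=> 0).

Definition approx_repr gamma q (h : approx_space gamma q) : nat -> V :=
  xget (fun=> 0) (approx_class h).

Definition approx_norm gamma q (h : approx_space gamma q) : R :=
  limn (fun n => pre_norm gamma q (approx_repr h n)).

(* The continuous extension to the completion of the inclusion of the span
   into V_a: the V_a-limit of a representing sequence. *)
Definition approx_incl (a : V -> V -> scalar R k) gamma q
    (h : approx_space gamma q) : V :=
  xget 0 [set l | form_norm a (approx_repr h n - l) @[n --> \oo] --> (0 : R)].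

Definition unit_weight : nat -> R := fun=> 1.

Definition direction i (r : Vi i) : V :=
  if r == 0 then 0 else sreal k (hnorm r)^-1 *: Ri i r.

End Splitting.

(* Main.v *)
Require Import Defs.
From HB Require Import structures.
From mathcomp Require Import all_boot all_order all_algebra.
From mathcomp Require Import finmap complex.
From mathcomp Require Import all_classical all_reals all_analysis.
From mathcomp Require Import ring lra.

Set Implicit Arguments.
Unset Strict Implicit.
Unset Printing Implicit Defensive.

Import Order.TTheory GRing.Theory Num.Theory.
Import numFieldNormedType.Exports.

Local Open Scope classical_set_scope.
Local Open Scope ring_scope.

(** Since [a e (R_i v_i) = a_i (T_i e) v_i], Cauchy-Schwarz in each [V_{a_i}]
    bounds [Re a e (sum_i R_i v_i)] by [sum_i |r_i| |v_i|].  Taking out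
    [sup_i |r_i|], respectively [max_i |v_i| / pi_i], gives
    [Re a e u <= S * |u|] for every [u] in the span, where [S] is [sup_i |r_i|],
    respectively [sum_i pi_i |r_i|]; both sides are continuous, so the bound
    extends to the completion. *)

(** * Real numbers inside the real or complex scalar field *)

Section Scalars.
Context {R : realType} {k : scalar_kind}.
Implicit Types (x y : R) (z t : Defs.scalar R k).

Lemma sreB : {morph @sre R k : z t / z - t}.
Proof. by case: k => // -[? ?] [? ?]. Qed.

Lemma sre_sum (I : Type) (s : seq I) (F : I -> Defs.scalar R k) :
  sre (\sum_(i <- s) F i) = \sum_(i <- s) sre (F i).
Proof.
by case: k F => F //; apply: (big_morph (@complex.Re R)) => // -[? ?] [? ?].
Qed.

Lemma sreMreal x z : sre (sreal k x * z) = x * sre z.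
Proof. by case: k z => [//|] [? ?] /=; rewrite mul0r subr0. Qed.

Lemma sre_conj z : sre (sconj z) = sre z.
Proof. by case: k z => [//|] [? ?]. Qed.

Lemma sconj_sreal x : sconj (sreal k x) = sreal k x.
Proof. by case: k => //=; rewrite oppr0. Qed.

Lemma sre0 : sre (0 : Defs.scalar R k) = 0.
Proof. by case: k. Qed.

Lemma sreal0 : sreal k (0 : R) = 0.
Proof. by case: k. Qed.

Lemma srealB : {morph @sreal R k : x y / x - y}.
Proof. by case: k => // x y; apply/eqP; rewrite eq_complex /= subrr !eqxx. Qed.

Lemma srealM : {morph @sreal R k : x y / x * y}.
Proof.
case: k => // x y; apply/eqP.
by rewrite eq_complex /= !mulr0 !mul0r addr0 subr0 !eqxx.
Qed.

Lemma sreal_sum (I : Type) (s : seq I) (F : I -> R) :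
  sreal k (\sum_(i <- s) F i) = \sum_(i <- s) sreal k (F i).
Proof.
apply: (big_morph (@sreal R k)); last exact: sreal0.
by case: k => // x y; apply/eqP; rewrite eq_complex /= addr0 !eqxx.
Qed.

(** Comparable complex numbers share their imaginary part, so a nonnegative one is real. *)
Lemma scalar_ge0 z : 0 <= z -> 0 <= sre z /\ z = sreal k (sre z).
Proof.
case: k z => [//|] [x y] /=.
by rewrite lecE /= => /andP[/eqP -> x0]; split.
Qed.

Lemma normr_sreal x : `|sreal k x| = sreal k `|x|.
Proof.
by case: k => //=; rewrite normc_def /= expr0n addr0 sqrtr_sqr.
Qed.

Lemma ltr_sreal x y : (sreal k x < sreal k y) = (x < y).
Proof. by case: k => //=; rewrite ltcR. Qed.

Lemma cvg_sreal (u : nat -> R) x :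
  u @ \oo --> x -> sreal k (u n) @[n --> \oo] --> sreal k x.
Proof.
move=> /cvgrPdist_lt ux; apply/cvgrPdist_lt => eps eps0.
(* The radius [eps] lives in the scalar field; being positive, it is the image of a real number. *)
have [_ epsE] := scalar_ge0 (ltW eps0).
move: eps0; rewrite epsE -sreal0 ltr_sreal => eps0.
near=> n; rewrite -srealB normr_sreal ltr_sreal.
by near: n; exact: ux.
Unshelve. all: by end_near. Qed.

End Scalars.

(** * Cauchy-Schwarz for semidefinite Hermitian forms *)

Section HermitianForms.
Context {R : realType} {k : scalar_kind} {V : lmodType (Defs.scalar R k)}.
Implicit Type f : {hermitian V for false & @sconj R k}.

Lemma form_norm_ge0 (f : V -> V -> Defs.scalar R k) v : 0 <= form_norm f v.
Proof. exact: sqrtr_ge0. Qed.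

Lemma sre_hermC f u v : sre (f u v) = sre (f v u).
Proof. by rewrite (hermitian_subproof u v) expr0 mul1r sre_conj. Qed.

Lemma sre_form_quadratic f u v (t : R) :
  sre (f (u - sreal k t *: v) (u - sreal k t *: v)) =
  sre (f u u) - 2 * t * sre (f u v) + t ^+ 2 * sre (f v v).
Proof.
rewrite linearBl !linearBr /= !(linearZl_LR f) !(linearZr_LR f) /= sconj_sreal.
rewrite !sreB !sreMreal (sre_hermC f v u); ring.
Qed.

(** The quadratic of [sre_form_quadratic] is nonnegative at every real [t]; a suitable [t] gives the
    bound. *)
Lemma sre_form_le f u v : (forall w, 0 <= sre (f w w)) ->
  sre (f u v) <= form_norm f u * form_norm f v.
Proof.
move=> f0; rewrite /form_norm -sqrtrM ?f0 //.
have [b0|b0] := lerP (sre (f u v)) 0; first exact: le_trans b0 (sqrtr_ge0 _).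
rewrite -[leLHS](gtr0_norm b0) -sqrtr_sqr ler_wsqrtr //.
have quad t := sre_form_quadratic f u v t.
have [c0|c0] := eqVneq (sre (f v v)) 0.
  (* Without its square term the quadratic is affine in [t]; this [t] makes it [- 1], a
     contradiction. *)
  have := f0 (u - sreal k ((sre (f u u) + 1) / (2 * sre (f u v))) *: v).
  rewrite quad c0; set B := sre (f u v) in b0 *; set A := sre (f u u).
  rewrite (_ : _ + _ = - 1); last by field; rewrite gt_eqF.
  by rewrite ler0N1.
have {}c0 : 0 < sre (f v v) by rewrite lt_neqAle eq_sym c0 f0.
(* This [t] minimises the quadratic. *)
have := f0 (u - sreal k (sre (f u v) / sre (f v v)) *: v).
rewrite quad; set B := sre (f u v); set A := sre (f u u).
rewrite (_ : _ + _ = A - B ^+ 2 / sre (f v v)); last by field; rewrite gt_eqF.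
by rewrite subr_ge0 ler_pdivrMr.
Qed.

Lemma form_norm0 f : form_norm f 0 = 0.
Proof. by rewrite /form_norm linear0l sre0 sqrtr0. Qed.

End HermitianForms.

(** * The real-valued norm of a Hilbert space *)

Section HilbertSpaces.
Context {R : realType} {k : scalar_kind} {V : hilbert_space R k}.

Lemma hdot_ge0 (v : V) : 0 <= hdot V v v.
Proof. by rewrite -hnormE exprn_ge0. Qed.

Lemma sre_hdot_ge0 (v : V) : 0 <= sre (hdot V v v).
Proof. by have [] := scalar_ge0 (hdot_ge0 v). Qed.

Lemma hnorm_ge0 (v : V) : 0 <= hnorm v.
Proof. exact: form_norm_ge0. Qed.

Lemma hdotE (v : V) : hdot V v v = sreal k (hnorm v ^+ 2).
Proof.
have [v0 {1}->] := scalar_ge0 (hdot_ge0 v).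
by rewrite /hnorm /form_norm sqr_sqrtr.
Qed.

Lemma hnorm0 : hnorm (0 : V) = 0.
Proof. exact: form_norm0. Qed.

Lemma hnorm_eq0 (v : V) : hnorm v = 0 -> v = 0.
Proof.
move=> v0; have := hdotE v; rewrite v0 expr0n /= sreal0 -hnormE.
by move/eqP; rewrite sqrf_eq0 normr_eq0 => /eqP.
Qed.

Lemma sre_hdot_le (u v : V) : sre (hdot V u v) <= hnorm u * hnorm v.
Proof. exact: (sre_form_le u v sre_hdot_ge0). Qed.

End HilbertSpaces.

(** * Duality bounds on the span and on its completion *)

Section Duality.
Context {R : realType} {k : scalar_kind}.
Context {V : hilbert_space R k} {a : {hermitian V for false & @sconj R k}}.
Context {Vi : nat -> hilbert_space R k} {Ri : forall i, {linear Vi i -> V}}.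
Context {T : forall i, V -> Vi i}.
Hypothesis a_ge0 : forall v, 0 <= sre (a v v).
Hypothesis T_def : forall i v (vi : Vi i),
  hdot (Vi i) (T i v) vi = a v (Ri i vi).
Implicit Types (e u : V) (gamma : nat -> R) (q : \bar R).

Lemma form_direction e i :
  a e (direction Ri (T i e)) = sreal k (hnorm (T i e)).
Proof.
rewrite /direction; case: eqVneq => [->|r0].
  by rewrite linear0r hnorm0 sreal0.
rewrite (linearZr_LR a) /= sconj_sreal -T_def hdotE -srealM; congr sreal.
rewrite expr2 mulKf //; apply: contra_neq r0; exact: hnorm_eq0.
Qed.

(** Testing the definition of [T] with [T i e] itself gives its squared norm; after Cauchy-Schwarz
    one factor cancels. The bound is uniform in [i] when [L] is, and the absolute value covers a
    negative [L]. *)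
Lemma hnorm_T_le (L : R) e i :
  (forall v : Vi i, form_norm a (Ri i v) <= L * hnorm v) ->
  hnorm (T i e) <= form_norm a e * `|L|.
Proof.
move=> RL; have [->|r0] := eqVneq (hnorm (T i e)) 0.
  by rewrite mulr_ge0 ?form_norm_ge0.
have {}r0 : 0 < hnorm (T i e) by rewrite lt_neqAle eq_sym r0 hnorm_ge0.
rewrite -(ler_pM2r r0) -expr2.
have -> : hnorm (T i e) ^+ 2 = sre (a e (Ri i (T i e))).
  by rewrite -T_def sqr_sqrtr ?sre_hdot_ge0.
apply: le_trans (sre_form_le _ _ a_ge0) _.
rewrite -mulrA ler_wpM2l ?form_norm_ge0 // (le_trans (RL _)) //.
by rewrite ler_wpM2r ?hnorm_ge0 ?ler_norm.
Qed.

Lemma sre_form_finite_sum_le e (I : {fset nat}) (v : forall i, Vi i) :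
  sre (a e (finite_sum Ri I v)) <= \sum_(i <- I) hnorm (T i e) * hnorm (v i).
Proof.
rewrite linear_sumr sre_sum; apply: ler_sum => i _.
by have := sre_hdot_le (T i e) (v i); rewrite T_def.
Qed.

(** A bound valid for every representation of [u] passes to the infimum. The case [S = 0] is apart
    because the argument divides by [S]. *)
Lemma sre_form_le_pre_norm gamma q e u (S : R) : 0 <= S ->
  (forall (I : {fset nat}) (v : forall i, Vi i), [set` I] `<=` supp gamma ->
    sre (a e (finite_sum Ri I v)) <=
      S * lq_norm q [seq (gamma i)^-1 * hnorm (v i) | i <- I]) ->
  range_span Ri (supp gamma) u ->
  sre (a e u) <= S * pre_norm Ri gamma q u.
Proof.
rewrite le_eqVlt => /predU1P[<- leS|S0 leS] [I [v [Igamma uE]]].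
  by rewrite mul0r uE (le_trans (leS _ _ Igamma)) ?mul0r.
rewrite mulrC -ler_pdivrMr //; apply: lb_le_inf.
  by exists (lq_norm q [seq (gamma i)^-1 * hnorm (v i) | i <- I]), I, v.
move=> _ [J [w [Jgamma -> ->]]].
by rewrite ler_pdivrMr // mulrC; exact: leS.
Qed.

Lemma lq_norm_ge0 q (s : seq R) : 0 <= lq_norm q s.
Proof.
case: q => [r||] //=; first exact: powR_ge0.
by elim/big_rec: _ => // x y _ y0; rewrite le_max y0 orbT.
Qed.

Lemma pre_norm_ge0 gamma q u : 0 <= pre_norm Ri gamma q u.
Proof.
rewrite /pre_norm; set N := [set t | _].
(* Outside the span no representation exists, and the infimum of the empty set is [0]. *)
have [->|/set0P N0] := eqVneq N set0; first by rewrite inf0.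
by apply: lb_le_inf N0 _ => _ [I [v [_ _ ->]]]; exact: lq_norm_ge0.
Qed.

Lemma approx_repr_span gamma q (h : approx_space Ri gamma q) n :
  range_span Ri (supp gamma) (approx_repr h n).
Proof.
rewrite /approx_repr; case: xgetP => [_ ->|_].
  by have [x _ ->] := approx_classP h => -[[]].
(* The default of [xget], the zero sequence, lies in the span as an empty sum. *)
by exists fset0, (fun=> 0); split=> [i //|]; rewrite /finite_sum big_seq_fset0.
Qed.

(* [approx_incl] and [approx_norm] are 0 if the limits defining them do not
   exist, and [0^-1 = 0]; the left-hand side vanishes in all these cases. *)
Lemma sre_form_approx_le gamma q (h : approx_space Ri gamma q) e (S : R) :
  0 <= S ->
  (forall u, range_span Ri (supp gamma) u ->
    sre (a e u) <= S * pre_norm Ri gamma q u) ->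
  (approx_norm h)^-1 * sre (a e (approx_incl a h)) <= S.
Proof.
move=> S0 leS; rewrite /approx_incl; case: xgetP => [l _ /= hl|_]; last first.
  by rewrite linear0r sre0 mulr0.
have [cN|/dvgP N0] :=
    pselect (cvgn (fun n => pre_norm Ri gamma q (approx_repr h n))); last first.
  by rewrite /approx_norm N0 invr0 mul0r.
have N0 : 0 <= approx_norm h.
  by apply: limr_ge => //; near=> n; exact: pre_norm_ge0.
have : sre (a e l) <= S * approx_norm h.
  (* The added zero is the limit of the Cauchy-Schwarz bound on the error of replacing [l] by
     [approx_repr h n]. *)
  have -> : S * approx_norm h = S * approx_norm h + form_norm a (- e) * 0.
    by rewrite mulr0 addr0.
  apply: ler_cvg_to (cvg_cst _) (cvgD (cvgM (cvg_cst S) cN)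
    (cvgM (cvg_cst _) hl)) _.
  near=> n => /=.
  have -> : sre (a e l) =
      sre (a e (approx_repr h n)) + sre (a (- e) (approx_repr h n - l)).
    by rewrite linearNl -linearNr opprB linearBr sreB addrC subrK.
  rewrite lerD ?sre_form_le //; apply: leS; exact: approx_repr_span.
move: N0; rewrite le_eqVlt => /predU1P[<-|N0]; first by rewrite invr0 mul0r.
by rewrite [_^-1 * _]mulrC ler_pdivrMr.
Unshelve. all: by end_near. Qed.

End Duality.

(** * Finite sequence norms and series with nonnegative terms *)

Lemma lq_norm1 (R : realType) (s : seq R) :
  lq_norm 1%:E s = \sum_(x <- s) `|x|.
Proof.
rewrite /= invr1 powRr1; last by apply: sumr_ge0 => x _; exact: powR_ge0.
by apply: eq_bigr => x _; rewrite powRr1.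
Qed.

Lemma ler_lq_normy (R : realType) (s : seq R) x :
  x \in s -> x <= lq_norm +oo%E s.
Proof.
by move=> xs; apply: le_trans (ler_norm x) _; exact: le_bigmax_seq.
Qed.

Lemma sum_fset_le_limn (R : realType) (u : nat -> R) (I : {fset nat}) :
  (forall i, 0 <= u i) -> cvgn (series u) ->
  \sum_(i <- I) u i <= limn (series u).
Proof.
move=> u0 cu.
have [n In] : exists n, {subset I <= index_iota 0 n}.
  (* The successor, since [index_iota] excludes its upper end. *)
  exists (\max_(i <- I) i).+1 => i iI.
  by rewrite mem_index_iota ltnS; exact: leq_bigmax_seq.
have : \sum_(i <- I) u i <= series u n.
  rewrite /series /= (perm_big [seq i <- index_iota 0 n | i \in I]); last first.
    apply: uniq_perm; rewrite ?filter_uniq ?iota_uniq ?fset_uniq // => i.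
    by rewrite mem_filter andb_idr // => /In.
  rewrite big_filter big_mkcond; apply: ler_sum => i _ /=.
  by case: ifP.
move/le_trans; apply; apply: nondecreasing_cvgn_le => //.
exact: nondecreasing_series.
Qed.

Theorem lemma1 (R : realType) (k : scalar_kind)
    (V : hilbert_space R k) (a : {hermitian V for false & @sconj R k})
    (Vi : nat -> hilbert_space R k) (Ri : forall i : nat, {linear Vi i -> V})
    (splitting : space_splitting Ri a)
    (Lambda : R)
    (Ri_le : forall (i : nat) (v : Vi i),
       form_norm a (Ri i v) <= Lambda * hnorm v)
    (T : forall i : nat, V -> Vi i)
    (T_def : forall (i : nat) (v : V) (vi : Vi i),
       hdot (Vi i) (T i v) vi = a v (Ri i vi))
    (e : V) :
  let r := fun i : nat => T i e in
  let w := fun i : nat => direction Ri (r i) in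
  (forall (istar : nat) (beta : R),
     0 < beta -> beta <= 1 ->
     beta * sup (range (fun i : nat => hnorm (r i))) <= hnorm (r istar) ->
     forall h : approx_space Ri unit_weight 1%:E, approx_nontrivial h ->
       sreal k (hnorm (r istar)) = a e (w istar) /\
       beta / approx_norm h * sre (a e (approx_incl a h)) <= hnorm (r istar))
  /\
  (forall p : nat -> R, prob_distr p ->
     forall h : approx_space Ri p +oo%E, approx_nontrivial h ->
       [/\ cvgn (series (fun i : nat => p i * hnorm (r i))),
           cvgn (series (fun i : nat => sreal k (p i) * a e (w i))),
           sreal k (limn (series (fun i : nat => p i * hnorm (r i)))) =
             limn (series (fun i : nat => sreal k (p i) * a e (w i)))
         & (approx_norm h)^-1 * sre (a e (approx_incl a h)) <=
             limn (series (fun i : nat => p i * hnorm (r i)))]).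
Proof.
move=> r w.
have a_ge0 v : 0 <= sre (a v v).
  have [c c0 ca] := splitting_coercive splitting.
  by apply: le_trans (ca v); rewrite mulr_ge0 ?sqr_ge0 // ltW.
have r_le i : hnorm (r i) <= form_norm a e * `|Lambda|.
  by apply: hnorm_T_le => // v; exact: Ri_le.
have wE i : a e (w i) = sreal k (hnorm (r i)) by exact: form_direction.
split=> [istar beta beta0 _ r_ge h _|p [p0 p1] h _].
  split; first by rewrite wE.
  have r_sup i : hnorm (r i) <= sup (range (fun j => hnorm (r j))).
    apply: sup_upper_bound; last by exists i.
    split; first by exists (hnorm (r 0%N)), 0%N.
    (* The uniform bound makes [sup] a genuine supremum rather than its default value. *)
    by exists (form_norm a e * `|Lambda|) => _ [j _ <-].
  have sup0 := le_trans (hnorm_ge0 _) (r_sup 0%N).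
  (* With [beta] cancelled, the completion bound remains to be shown for [S] the supremum. *)
  apply: le_trans r_ge; rewrite -mulrA ler_pM2l //.
  apply: sre_form_approx_le => // u; apply: sre_form_le_pre_norm => // I v _.
  rewrite lq_norm1 big_map mulr_sumr.
  apply: le_trans (sre_form_finite_sum_le T_def _ _ _) _; apply: ler_sum => i _.
  by rewrite invr1 mul1r ger0_norm ?hnorm_ge0 // ler_wpM2r ?hnorm_ge0.
have pr0 i : 0 <= p i * hnorm (r i) by rewrite mulr_ge0 ?hnorm_ge0.
have cpr : cvgn (series (fun i => p i * hnorm (r i))).
  (* Comparison with [M] times the convergent series of the [p i]. *)
  pose M := form_norm a e * `|Lambda|.
  have cp : cvgn (series (M *: (p : R^nat))).
    by apply: is_cvg_seriesZ; apply/cvg_ex; exists 1.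
  apply: series_le_cvg cp => // i.
    by rewrite -[leRHS]/(M * p i) !mulr_ge0 ?form_norm_ge0.
  by rewrite -[leRHS]/(M * p i) mulrC ler_wpM2r.
have pwE : series (fun i => sreal k (p i) * a e (w i)) =
    (fun n => sreal k (series (fun i => p i * hnorm (r i)) n)).
  apply/funext => n; rewrite /series /= sreal_sum.
  by apply: eq_bigr => i _; rewrite wE srealM.
have cpw := cvg_sreal (k := k) cpr.
split=> //.
- by rewrite pwE; apply/cvg_ex; eexists; exact: cpw.
- by rewrite pwE; apply/esym/cvg_lim.
have lim0 : 0 <= limn (series (fun i => p i * hnorm (r i))).
  by apply: limr_ge => //; near=> n; apply: sumr_ge0.
apply: sre_form_approx_le => // u; apply: sre_form_le_pre_norm => // I v Ip.
apply: le_trans (sre_form_finite_sum_le T_def _ _ _) _.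
set N := lq_norm _ _.
(* Each [(p i)^-1 * hnorm (v i)] is at most the maximum [N], and [p i > 0] on the support, so
   [hnorm (v i) <= p i * N]. *)
apply: (@le_trans _ _ ((\sum_(i <- I) p i * hnorm (r i)) * N)).
  rewrite mulr_suml big_seq [leRHS]big_seq; apply: ler_sum => i iI.
  have pi0 : 0 < p i by exact: Ip.
  rewrite [p i * _]mulrC -mulrA ler_wpM2l ?hnorm_ge0 // -ler_pdivrMl //.
  by apply: ler_lq_normy; apply: map_f.
by rewrite ler_wpM2r ?lq_norm_ge0 ?sum_fset_le_limn.
Unshelve. all: by end_near. Qed.
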